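(* Let $\mathcal A$ be a separable real Banach space and $\mathcal B=\mathcal A'$ its dual, with weak\* topology $w^*$. Let $\Theta$ be a parameter set, $\theta\mapsto f_\theta\in\mathcal B$ a parametric model, $C:\Theta\to[0,+\infty)$ a parameter cost, $R_\Theta:\mathcal B\to[0,+\infty]$ the parametric representation cost, $R$ its $w^*$-l.s.c. regularization, and $\mathcal F=\{f\in\mathcal B:R(f)<+\infty\}$. Let $q>0$ and $0<p\le1$. Assume that $R_\Theta=Q_\Theta^q$, where $Q_\Theta:\mathcal B\to[0,+\infty]$ is subadditive and absolutely $p$-homogeneous, and that $R_\Theta$ is coercive. Then $R^{1/(pq)}$ is a $p$-norm on $\mathcal F$. Moreover, $\mathcal F$ is complete with respect to the metric $$d(f,g):=R(f-g)^{1/q},\qquad f,g\in\mathcal F.$$ In particular, $\mathcal F$ is a $p$-normable quasi-Banach space. When $p=1$, $\mathcal F$ is a Banach space.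
   Context: **Representation cost.** $w^*=\sigma(\mathcal B,\mathcal A)$. $\mathcal F_\Theta=\{f_\theta:\theta\in\Theta\}$. $R_\Theta(f)=\inf\{C(\theta):\theta\in\Theta,\ f_\theta=f\}$ for $f\in\mathcal F_\Theta$ and $R_\Theta(f)=+\infty$ for $f\in\mathcal B\setminus\mathcal F_\Theta$. A function $K:\mathcal B\to[-\infty,+\infty]$ is $w^*$-l.s.c. if all sublevel sets $\{K\le\alpha\}$, $\alpha\in\mathbb R$, are $w^*$-closed; its $w^*$-l.s.c. regularization is the largest $w^*$-l.s.c. function bounded above by $K$. **Properties of functions $K:\mathcal B\to[0,+\infty]$.** Subadditive: $K(f+g)\le K(f)+K(g)$. Absolutely $p$-homogeneous: $K(0)=0$ and $K(\alpha f)=|\alpha|^pK(f)$ for all $\alpha\in\mathbb R\setminus\{0\}$, $f\in\mathcal B$. Coercive: every sublevel set $\{K\le\alpha\}$, $\alpha\in\mathbb R$, is norm-bounded. **Quasi-norms.** A quasi-seminorm $Q$ on a real vector space is a $[0,\infty)$-valued absolutely $1$-homogeneous function with $Q(f+g)\le c(Q(f)+Q(g))$ for some constant $c$. For $0<p\le1$, it is a $p$-seminorm if $Q(f+g)^p\le Q(f)^p+Q(g)^p$, and a $p$-norm if in addition $Q(f)=0\Rightarrow f=0$. A quasi-normed space is $p$-normable if its topology is induced by an equivalent $p$-norm; quasi-Banach means complete quasi-normed. *)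

(* Defs.v *)
From HB Require Import structures.
From mathcomp Require Import all_boot all_order all_algebra.
From mathcomp Require Import all_classical all_reals all_analysis.

Set Implicit Arguments.
Unset Strict Implicit.
Unset Printing Implicit Defensive.

Import Order.TTheory GRing.Theory Num.Theory.
Import numFieldTopology.Exports numFieldNormedType.Exports.

Local Open Scope classical_set_scope.
Local Open Scope ring_scope.

Definition linear_subspace (R : realType) (V : lmodType R) (F : set V) : Prop :=
  F 0 /\ forall (a : R) (f g : V), F f -> F g -> F (a *: f + g).

(* A linear subspace as a vector space in its own right; [val] is the inclusion. *)
Definition subspace_type (R : realType) (V : lmodType R) (F : set V)
  (hF : linear_subspace F) : Type := {f : V | f \in F}.

Section SubspaceType.
Variables (R : realType) (V : lmodType R) (F : set V) (hF : linear_subspace F).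

Lemma linear_subspace_closed : subsemimod_closed (fun f : V => f \in F).
Proof.
case: hF => F0 FZ; split; first split.
- by rewrite unfold_in /= in_setE.
- move=> f g; rewrite !unfold_in !in_setE => Ff Fg.
  by rewrite -(scale1r f); exact: FZ.
- move=> a f; rewrite !unfold_in !in_setE => Ff.
  by rewrite -(addr0 (a *: f)); exact: FZ.
Qed.

HB.instance Definition _ := Choice.on (subspace_type hF).
HB.instance Definition _ := SubChoice.on (subspace_type hF).
HB.instance Definition _ := GRing.SubChoice_isSubLmodule.Build R V _
  (subspace_type hF) linear_subspace_closed.

End SubspaceType.

Section Dual.
Variables (R : realType) (A : normedModType R).

Definition continuous_functionals : set (A -> R^o) :=
  [set f | linear f /\ continuous f].

Lemma continuous_functionals_subspace : linear_subspace continuous_functionals.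
Proof.
split.
  split; first by move=> a x y /=; rewrite scaler0 addr0.
  exact: cst_continuous.
move=> a f g [lf cf] [lg cg]; split.
  move=> b x y; rewrite !fctE lf lg !scalerDr !scalerA (mulrC a b) !addrA.
  by congr (_ + _); rewrite -!addrA; congr (_ + _); rewrite addrC.
move=> x; apply: (@continuousD _ _ _ (fun x => a *: f x) g); last exact: cg.
by apply: continuousZr; exact: cf.
Qed.

Definition dual : Type := subspace_type continuous_functionals_subspace.
HB.instance Definition _ := GRing.Lmodule.on dual.

Definition dual_fun (f : dual) : A -> R^o := \val f.
Coercion dual_fun : dual >-> Funclass.

Definition dual_norm (f : dual) : R :=
  sup [set `|f x| | x in [set x : A | `|x| <= 1]].

Lemma dual_linear (f : dual) : linear f.
Proof. by have /set_mem[] := valP f. Qed.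

Lemma dual_continuous (f : dual) : continuous f.
Proof. by have /set_mem[] := valP f. Qed.

Lemma dual_norm_has_sup (f : dual) :
  has_sup [set `|f x| | x in [set x : A | `|x| <= 1]].
Proof.
pose lf : {linear A -> R^o} :=
  HB.pack (dual_fun f) (GRing.isLinear.Build _ _ _ _ _ (@dual_linear f)).
split; first by exists `|f 0|; exists 0 => //=; rewrite normr0.
have /bounded_funP/(_ 1)[M hM] : bounded_near lf (nbhs (0 : A)).
  by apply/linear_bounded_continuous; exact: dual_continuous.
by exists M => _ [x /= x1 <-]; exact: hM.
Qed.

Lemma dual_norm_ub (f : dual) (x : A) : `|x| <= 1 -> `|f x| <= dual_norm f.
Proof.
by move=> x1; apply: sup_upper_bound; [exact: dual_norm_has_sup|exists x].
Qed.

Lemma dual_norm_le (f : dual) (M : R) :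
  (forall x : A, `|x| <= 1 -> `|f x| <= M) -> dual_norm f <= M.
Proof.
move=> h; apply: ge_sup; first by case: (dual_norm_has_sup f).
by move=> _ [x /= x1 <-]; exact: h.
Qed.

Lemma dual_norm_ge0 (f : dual) : 0 <= dual_norm f.
Proof.
by apply: le_trans (@dual_norm_ub f 0 _); rewrite ?normr_ge0 ?normr0.
Qed.

Lemma dual_norm_triangle (f g : dual) :
  dual_norm (f + g) <= dual_norm f + dual_norm g.
Proof.
apply: dual_norm_le => x x1; apply: le_trans (ler_normD (f x) (g x)) _.
by apply: lerD; exact: dual_norm_ub.
Qed.

Lemma dual_norm_scale_le (a : R) (f : dual) :
  dual_norm (a *: f) <= `|a| * dual_norm f.
Proof.
apply: dual_norm_le => x x1.
rewrite (_ : (a *: f : dual) x = a * f x)// normrM.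
by apply: ler_wpM2l => //; exact: dual_norm_ub.
Qed.

Lemma dual_norm_eq0 (f : dual) : dual_norm f = 0 -> f = 0.
Proof.
move=> f0; apply/val_inj/funext => x /=.
have small y : `|y| <= 1 -> f y = 0.
  move=> y1; apply/eqP; rewrite -normr_le0 -f0; exact: dual_norm_ub.
have [->|x0] := eqVneq x 0; first by apply: small; rewrite normr0.
have fZ : f (`|x|^-1 *: x) = `|x|^-1 * f x.
  have l0 : f 0 = 0 by apply: small; rewrite normr0.
  by have := @dual_linear f `|x|^-1 x 0; rewrite l0 !addr0.
have : f (`|x|^-1 *: x) = 0.
  by apply: small; rewrite normrZ normfV normr_id mulVf ?normr_eq0.
rewrite fZ => /eqP; rewrite mulf_eq0 invr_eq0 normr_eq0 (negbTE x0) /=.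
by move/eqP.
Qed.

Lemma dual_norm_scale (a : R) (f : dual) :
  dual_norm (a *: f) = `|a| * dual_norm f.
Proof.
apply/eqP; rewrite eq_le dual_norm_scale_le /=.
have [->|a0] := eqVneq a 0; first by rewrite normr0 mul0r dual_norm_ge0.
rewrite -ler_pdivlMl ?normr_gt0// -normfV.
by apply: le_trans (dual_norm_scale_le _ _); rewrite scalerA mulVf// scale1r.
Qed.

HB.instance Definition _ := @Lmodule_isNormed.Build R dual dual_norm
  dual_norm_triangle dual_norm_scale dual_norm_eq0.

(* The weak* topology sigma(A', A): the initial topology for the evaluations
   f |-> f x, i.e. the one induced by pointwise convergence on A. *)
Definition weak_star : Type :=
  @initial_topology dual {ptws A -> R^o} (fun f : dual => dual_fun f).
HB.instance Definition _ := Topological.on weak_star.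

End Dual.

Definition separable_space (T : topologicalType) : Prop :=
  exists2 D : set T, countable D & dense D.

Section RepresentationCost.
Variables (R : realType) (A : normedModType R).
Local Open Scope ereal_scope.

(* [closed] is taken in [weak_star A], not in the norm topology of [dual A]. *)
Definition weak_star_lsc (K : dual A -> \bar R) : Prop :=
  forall a : R, closed ([set f | K f <= a%:E] : set (weak_star A)).

(* The largest w*-l.s.c. minorant, as the pointwise supremum of all of them;
   see [lsc_regularization_largest]. *)
Definition lsc_regularization (K : dual A -> \bar R) (f : dual A) : \bar R :=
  ereal_sup [set L f | L in
    [set L : dual A -> \bar R | weak_star_lsc L /\ forall g, L g <= K g]].

Lemma lsc_regularization_largest (K : dual A -> \bar R) :
  [/\ weak_star_lsc (lsc_regularization K),
      forall f, lsc_regularization K f <= K f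
    & forall L : dual A -> \bar R, weak_star_lsc L -> (forall f, L f <= K f) ->
        forall f, L f <= lsc_regularization K f].
Proof.
split.
- move=> a.
  rewrite (_ : [set f | _] = \bigcap_(L in
    [set L : dual A -> \bar R | weak_star_lsc L /\ forall g, L g <= K g])
    [set f | L f <= a%:E]).
    by apply: closed_bigI => L -[Llsc _]; exact: Llsc.
  apply/seteqP; split=> f /=.
    move=> fa L hL; apply: le_trans fa.
    by apply: ereal_sup_ubound; exists L.
  by move=> h; apply: ge_ereal_sup => _ [L hL <-]; exact: h.
- by move=> f; apply: ge_ereal_sup => _ [L [_ LK] <-]; exact: LK.
- by move=> L hL LK f; apply: ereal_sup_ubound; exists L.
Qed.

(* The infimum of the empty set is +oo, so this is +oo off the range of the
   model. *)
Definition representation_cost (Theta : Type) (model : Theta -> dual A)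
    (C : Theta -> R) (f : dual A) : \bar R :=
  ereal_inf [set (C t)%:E | t in [set t | model t = f]].

End RepresentationCost.

Section FunctionProperties.
Variables (R : realType).
Local Open Scope ereal_scope.

Definition ereal_subadditive (V : lmodType R) (K : V -> \bar R) : Prop :=
  forall f g, K (f + g)%R <= K f + K g.

Definition abs_homogeneous (V : lmodType R) (p : R) (K : V -> \bar R) : Prop :=
  K 0%R = 0 /\
  forall (a : R) (f : V), a != 0%R -> K (a *: f)%R = (`|a| `^ p)%:E * K f.

Definition coercive (V : normedModType R) (K : V -> \bar R) : Prop :=
  forall a : R, bounded_set [set f | K f <= a%:E].

End FunctionProperties.

Section QuasiNorms.
Variables (R : realType) (V : lmodType R).
Implicit Types (p : R) (P Q : V -> R).

Definition quasi_seminorm Q : Prop :=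
  [/\ forall f, 0 <= Q f,
      abs_homogeneous 1 (fun f => (Q f)%:E)
    & exists c : R, forall f g, Q (f + g) <= c * (Q f + Q g)].

Definition quasi_norm Q : Prop :=
  quasi_seminorm Q /\ forall f, Q f = 0 -> f = 0.

Definition p_seminorm p Q : Prop :=
  quasi_seminorm Q /\ forall f g, Q (f + g) `^ p <= Q f `^ p + Q g `^ p.

Definition p_norm p Q : Prop :=
  p_seminorm p Q /\ forall f, Q f = 0 -> f = 0.

Definition quasi_norm_open Q (U : set V) : Prop :=
  forall f, U f ->
    exists2 e : R, 0 < e & forall g, Q (g - f) < e -> U g.

Definition equivalent_quasi_norms P Q : Prop :=
  exists c C : R, [/\ 0 < c, 0 < C & forall f, c * Q f <= P f <= C * Q f].

Definition p_normable p Q : Prop :=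
  exists P, [/\ p_norm p P, equivalent_quasi_norms P Q
    & forall U, quasi_norm_open P U <-> quasi_norm_open Q U].

End QuasiNorms.

Section Completeness.
Variables (R : realType).

Definition is_metric (T : Type) (d : T -> T -> R) : Prop :=
  [/\ forall x y, 0 <= d x y,
      forall x y, d x y = 0 <-> x = y,
      forall x y, d x y = d y x
    & forall x y z, d x z <= d x y + d y z].

(* The triangle inequality is not required of d, so that this also applies to
   (f, g) |-> Q (f - g) for a quasi-norm Q. *)
Definition cauchy_complete (T : Type) (d : T -> T -> R) : Prop :=
  forall u : nat -> T,
    (forall e : R, 0 < e ->
      exists N, forall m n, (N <= m)%N -> (N <= n)%N -> d (u m) (u n) < e) ->
    exists l : T, d (u n) l @[n --> \oo] --> (0 : R).

Definition quasi_banach (V : lmodType R) (Q : V -> R) : Prop :=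
  quasi_norm Q /\ cauchy_complete (fun f g => Q (f - g)).

(* V normed by N is a Banach space: it is isometrically isomorphic to some
   complete normed module. *)
Definition banach (V : lmodType R) (N : V -> R) : Prop :=
  exists (X : completeNormedModType R) (phi : {linear V -> X}),
    bijective phi /\ forall f, `|phi f| = N f.

End Completeness.

(* Main.v *)
Require Import Defs.
From HB Require Import structures.
From mathcomp Require Import all_boot all_order all_algebra.
From mathcomp Require Import all_classical all_reals all_analysis.

(** Taking [q]-th powers commutes with w*-l.s.c. regularization, so
[R = S `^ q] where [S] is the regularization of [Q].  Everything about [S]
follows from its being the largest w*-l.s.c. minorant of [Q], by exhibiting
minorants: translates give subadditivity, dilates give homogeneity, and since
[Q] dominates a power [(`|f| / M) `^ p] of the w*-l.s.c. dual norm, so does [S].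
Hence a sequence that is Cauchy for [S] is Cauchy in norm and converges pointwise
to a functional [l]; as sublevel sets of [S] are w*-closed, it also converges
to [l] for [S]. *)

Set Implicit Arguments.
Unset Strict Implicit.
Unset Printing Implicit Defensive.

Import Order.TTheory GRing.Theory Num.Theory.
Import numFieldTopology.Exports numFieldNormedType.Exports.

Local Open Scope classical_set_scope.
Local Open Scope ring_scope.

(** * Pointwise criteria for weak* convergence and continuity *)

Section WeakStar.
Variables (R : realType) (A : normedModType R).

(** A w*-open set is the preimage of an open set for pointwise convergence. Keeping the filter
    arbitrary serves both continuity of maps and limits of sequences. *)
Lemma weak_star_cvg (T : Type) (G : set_system T) (FG : Filter G)
    (u : T -> dual A) (f : dual A) :
  (forall x, u t x @[t --> G] --> f x) -> u @ G --> (f : weak_star A).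
Proof.
move=> ux U [_ [[W oW <-] /= Wf sWU]].
have : {ptws, (fun t => dual_fun (u t)) @ G --> dual_fun f}.
  by apply/pointwise_cvgP.
move=> /(_ W (open_nbhs_nbhs (conj oW Wf))) GW.
exact: (@filterS _ G _ _ _ (fun t => @sWU (u t)) GW).
Qed.

Lemma weak_star_continuous_eval (x : A) :
  continuous (fun f : weak_star A => (f : dual A) x).
Proof.
move=> f; have := @initial_continuous (dual A) {ptws A -> R^o} (fun g : dual A => dual_fun g) f.
by move/(pointwise_cvgP _ (fmap_filter _ (nbhs_filter _))) => /(_ x).
Qed.

Lemma weak_star_continuous (T : topologicalType) (u : T -> dual A) :
  (forall x, continuous (fun t => u t x)) -> continuous (u : T -> weak_star A).
Proof. by move=> ux t; apply: weak_star_cvg => x; exact: ux. Qed.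

Lemma weak_star_continuous_shift (h : dual A) :
  continuous ((fun f => f + h) : weak_star A -> weak_star A).
Proof.
apply: weak_star_continuous => x f.
have : ((g : dual A) x + h x : R^o) @[g --> f] --> ((f : dual A) x + h x : R^o).
  exact: (cvgD (@weak_star_continuous_eval x f) (cvg_cst _)).
exact.
Qed.

Lemma weak_star_continuous_scale (a : R) :
  continuous ((fun f : dual A => a *: f) : weak_star A -> weak_star A).
Proof.
apply: weak_star_continuous => x f.
have : (a * (g : dual A) x : R^o) @[g --> f] --> (a * (f : dual A) x : R^o).
  exact: (cvgM (cvg_cst _) (@weak_star_continuous_eval x f)).
exact.
Qed.

Lemma dual_eval_le (f : dual A) (x : A) : `|f x| <= `|f| * `|x|.
Proof.
have f0 : f 0 = 0.
  have := dual_linear f 1 0 0; rewrite !scale1r addr0 => /eqP.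
  by rewrite -subr_eq subrr eq_sym => /eqP.
have [->|x0] := eqVneq x 0; first by rewrite f0 !normr0 mulr0.
have : `|f (`|x|^-1 *: x)| <= `|f|.
  by apply: dual_norm_ub; rewrite normrZ normfV normr_id mulVf ?normr_eq0.
have -> : f (`|x|^-1 *: x) = `|x|^-1 * f x.
  by have := dual_linear f `|x|^-1 x 0; rewrite f0 !addr0.
by rewrite normrM normfV normr_id ler_pdivrMl ?normr_gt0// mulrC.
Qed.

End WeakStar.

(** * Monotonicity and inversion of powers *)

Section PowerFunction.
Variable R : realType.
Local Open Scope ereal_scope.

Lemma powR_inv (x r : R) : (0 <= x)%R -> (x^-1 `^ r = (x `^ r)^-1)%R.
Proof. by move=> x0; rewrite -powR_inv1// -powRrM mulN1r powRN. Qed.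

Lemma le_poweR (r : R) (x y : \bar R) :
  (0 < r)%R -> 0 <= x -> x <= y -> x `^ r <= y `^ r.
Proof.
move=> r0 x0 xy; apply: gt0_ler_poweR => //; first exact: ltW.
- by rewrite in_itv/= x0 leey.
- by rewrite in_itv/= (le_trans x0 xy) leey.
Qed.

Lemma poweRK (r : R) (x : \bar R) : r != 0%R -> 0 <= x -> (x `^ r) `^ r^-1 = x.
Proof. by move=> r0 x0; rewrite -poweRrM mulfV// poweRe1. Qed.

Lemma poweRVK (r : R) (x : \bar R) :
  r != 0%R -> 0 <= x -> (x `^ r^-1) `^ r = x.
Proof. by move=> r0 x0; rewrite -poweRrM mulVf// poweRe1. Qed.

End PowerFunction.

(** * Weak* lower semicontinuity and what the regularization inherits *)

Section Regularization.
Variables (R : realType) (A : normedModType R).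
Local Open Scope ereal_scope.
Implicit Types K L : dual A -> \bar R.

Lemma weak_star_lsc_comp (phi : dual A -> dual A) K :
  continuous (phi : weak_star A -> weak_star A) ->
  weak_star_lsc K -> weak_star_lsc (K \o phi).
Proof.
by move=> cphi lK a; apply: (@closed_comp _ _ _ _ _ (lK a)) => f _; exact: cphi.
Qed.

Lemma weak_star_lsc_cst (c : \bar R) : weak_star_lsc (fun _ : dual A => c).
Proof.
move=> a; have [ca|ca] := boolP (c <= a%:E).
  rewrite [X in closed X](_ : _ = setT); first exact: closedT.
  by apply/seteqP; split.
rewrite [X in closed X](_ : _ = set0); first exact: closed0.
by apply/seteqP; split => //= f; rewrite (negbTE ca).
Qed.

Lemma weak_star_lscB K (c : R) :
  weak_star_lsc K -> weak_star_lsc (fun f => K f - c%:E).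
Proof.
move=> lK a; rewrite [X in closed X](_ : _ = [set f | K f <= (a + c)%:E]).
  exact: lK.
by apply/seteqP; split=> f; rewrite /mkset EFinD leeBlDr.
Qed.

Lemma weak_star_lscZ K (c : R) : (0 < c)%R ->
  weak_star_lsc K -> weak_star_lsc (fun f => c%:E * K f).
Proof.
move=> c0 lK a; rewrite [X in closed X](_ : _ = [set f | K f <= (c^-1 * a)%:E]).
  exact: lK.
by apply/seteqP; split=> f /=; rewrite EFinM lee_pdivlMl.
Qed.

(** A sublevel set of the power at level [a] is the one of [K] at the [r]-th root of [a] when
    [0 <= a], and is empty when [a < 0]. *)
Lemma weak_star_lsc_poweR K (r : R) : (0 < r)%R -> (forall f, 0 <= K f) ->
  weak_star_lsc K -> weak_star_lsc (fun f => K f `^ r).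
Proof.
move=> r0 K0 lK a; have rN0 := lt0r_neq0 r0; have [a0|a0] := leP 0%R a.
  rewrite [X in closed X](_ : _ = [set f | K f <= (a `^ r^-1)%:E]).
    exact: lK.
  apply/seteqP; split=> f /= Kfa.
    rewrite -(poweRK rN0 (K0 f)) -poweR_EFin.
    by apply: le_poweR; rewrite ?invr_gt0 ?poweR_ge0.
  by have := le_poweR r0 (K0 f) Kfa; rewrite -poweR_EFin poweRVK// lee_fin.
rewrite [X in closed X](_ : _ = set0); first exact: closed0.
apply/seteqP; split=> //= f Kfa.
by have := le_trans (poweR_ge0 (K f) r) Kfa; rewrite lee_fin leNgt a0.
Qed.

(** The norm is a supremum of moduli of evaluations over the unit ball, so its sublevel sets are
    intersections of w*-closed sets. *)
Lemma weak_star_lsc_norm : weak_star_lsc (fun f : dual A => `|f|%:E).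
Proof.
move=> a; rewrite [X in closed X](_ : _ =
    \bigcap_(x in [set x : A | (`|x| <= 1)%R]) [set f : dual A | (`|f x| <= a)%R]).
  apply: closed_bigI => x _.
  apply: (@closed_comp _ _ (fun f : weak_star A => `|(f : dual A) x|%R)
    [set y | (y <= a)%R]); last exact: closed_le.
  by move=> f _; exact: (cvg_norm (@weak_star_continuous_eval _ _ x f)).
apply/seteqP; split=> f /=; rewrite lee_fin.
  by move=> fa x /= x1; apply: le_trans fa; exact: dual_norm_ub.
by move=> fa; apply: dual_norm_le => x x1; exact: fa.
Qed.

Lemma lsc_regularization_lsc K : weak_star_lsc (lsc_regularization K).
Proof. by case: (lsc_regularization_largest K). Qed.

Lemma lsc_regularization_le K f : lsc_regularization K f <= K f.
Proof. by case: (lsc_regularization_largest K). Qed.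

Lemma lsc_regularization_max K L : weak_star_lsc L -> (forall f, L f <= K f) ->
  forall f, L f <= lsc_regularization K f.
Proof. by case: (lsc_regularization_largest K) => _ _; exact. Qed.

Lemma lsc_regularization_ge0 K : (forall f, 0 <= K f) ->
  forall f, 0 <= lsc_regularization K f.
Proof. by move=> K0; apply: lsc_regularization_max => //; exact: weak_star_lsc_cst. Qed.

(** Powers with exponents [r] and [r^-1] are mutually inverse, monotone and preserve lower
    semicontinuity, so each side yields a competitor in the maximality that defines the other. *)
Lemma lsc_regularization_poweR K (r : R) : (0 < r)%R -> (forall f, 0 <= K f) ->
  forall f, lsc_regularization (fun g => K g `^ r) f = lsc_regularization K f `^ r.
Proof.
move=> r0 K0 f; have rN0 := lt0r_neq0 r0; apply/eqP; rewrite eq_le; apply/andP; split.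
  have Kr0 : forall g, 0 <= lsc_regularization (fun g => K g `^ r) g.
    by apply: lsc_regularization_ge0 => g; exact: poweR_ge0.
  rewrite -[leLHS](poweRVK rN0)//; apply: le_poweR; rewrite ?poweR_ge0//.
  have : forall g, lsc_regularization (fun g => K g `^ r) g `^ r^-1 <= K g.
    move=> g; rewrite -[leRHS](poweRK rN0)//.
    by apply: le_poweR; rewrite ?invr_gt0//; exact: lsc_regularization_le.
  move/lsc_regularization_max; apply.
  by apply: weak_star_lsc_poweR; rewrite ?invr_gt0//; exact: lsc_regularization_lsc.
move: f; apply: lsc_regularization_max.
  apply: weak_star_lsc_poweR => //; last exact: lsc_regularization_lsc.
  exact: lsc_regularization_ge0.
move=> f; apply: le_poweR => //; first exact: lsc_regularization_ge0.
exact: lsc_regularization_le.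
Qed.

(* The translated function [f |-> lsc_regularization K (f + h) - c] competes in
   the maximality of [lsc_regularization K], first with [c = K h] and then, the
   roles of [f] and [h] being exchanged, with [c = lsc_regularization K f]. *)
Lemma lsc_regularization_subadditive K : (forall f, 0 <= K f) ->
  ereal_subadditive K -> ereal_subadditive (lsc_regularization K).
Proof.
move=> K0 Ksub; set S := lsc_regularization K.
have S0 : forall f, 0 <= S f by exact: lsc_regularization_ge0.
have lscS h (c : R) : weak_star_lsc (fun f => S (f + h)%R - c%:E).
  apply: weak_star_lscB.
  apply: (weak_star_lsc_comp (@weak_star_continuous_shift _ _ h)).
  exact: lsc_regularization_lsc.
have SK f h : S (f + h)%R <= S f + K h.
  (* Subtracting [c] requires a finite value. If [K h] is [+oo] the bound is trivial, since [S] is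
     nonnegative and thus never [-oo]. *)
  have := K0 h; case Kh : (K h) => [c| |] // c0; last first.
    by rewrite addey ?leey// gt_eqF// (lt_le_trans (ltNye 0))// S0.
  rewrite -leeBlDr//; move: f; apply: lsc_regularization_max => // f.
  rewrite leeBlDr// -Kh; apply: le_trans (Ksub _ _).
  exact: lsc_regularization_le.
move=> f g; have := S0 f; case Sf : (S f) => [c| |] // c0; last first.
  by rewrite addye ?leey// gt_eqF// (lt_le_trans (ltNye 0))// S0.
rewrite addeC -leeBlDr// (addrC f); move: g; apply: lsc_regularization_max => // g.
by rewrite leeBlDr// -Sf addeC (addrC g); exact: SK.
Qed.

(** One inequality for all nonzero scalars suffices: applied to [a^-1] and [a *: f], it gives the
    reverse one. *)
Lemma lsc_regularization_homogeneous K (p : R) : (forall f, 0 <= K f) ->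
  abs_homogeneous p K -> abs_homogeneous p (lsc_regularization K).
Proof.
move=> K0 [K00 KZ]; set S := lsc_regularization K.
have S0 : forall f, 0 <= S f by exact: lsc_regularization_ge0.
have SZ_le (a : R) f : a != 0%R -> S (a *: f)%R <= (`|a| `^ p)%:E * S f.
  move=> a0; have ap0 : (0 < `|a| `^ p)%R by rewrite powR_gt0 ?normr_gt0.
  (* After division by the [p]-th power of the modulus of [a], the left side is a rescaled dilate of
     [S], an l.s.c. minorant of [K]. *)
  rewrite -lee_pdivrMl//; move: f; apply: lsc_regularization_max.
    apply: weak_star_lscZ; first by rewrite invr_gt0.
    apply: (weak_star_lsc_comp (@weak_star_continuous_scale _ _ a)).
    exact: lsc_regularization_lsc.
  by move=> f; rewrite lee_pdivrMl// -KZ//; exact: lsc_regularization_le.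
split=> [|a f a0].
  apply/eqP; rewrite eq_le S0 andbT -K00; exact: lsc_regularization_le.
apply/eqP; rewrite eq_le SZ_le//= -lee_pdivlMl ?powR_gt0 ?normr_gt0//.
have -> : ((`|a| `^ p)^-1 = `|a^-1| `^ p)%R.
  by rewrite normfV powR_inv.
by rewrite -{1}(scalerK a0 f) SZ_le// invr_neq0.
Qed.

(** Coercivity bounds the sublevel set of [K] at level 1 by some [M]; homogeneity rescales every [f]
    with finite [K f] into that set. *)
Lemma homogeneous_coercive_bound K (p r : R) : (0 < p)%R -> (0 < r)%R ->
  (forall f, 0 <= K f) -> abs_homogeneous p K -> coercive (fun f => K f `^ r) ->
  exists2 M : R, (0 < M)%R & forall f, (M^-1 * `|f|)%:E `^ p <= K f.
Proof.
move=> p0 r0 K0 [_ KZ] /(_ 1%R) Kb.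
have [M M0 KM] : exists2 M : R, (0 < M)%R & forall f, K f <= 1 -> (`|f| <= M)%R.
  have /pinfty_ex_gt0[M M0 hM] := Kb.
  exists M => // f Kf1; apply: hM => /=.
  by rewrite -(poweR1r r); exact: le_poweR.
exists M => // f; case Kf : (K f) (K0 f) => [c| |]// c0; last by rewrite leey.
(* The slack [e] keeps the scaling factor [b] positive even when [K f = 0]; [b] is chosen so that
   [K] is at most 1 at [b^-1 *: f]. *)
apply/lee_addgt0Pr => e e0; rewrite -EFinD.
have ce0 : (0 < c + e)%R by rewrite ltr_wpDl.
set b := ((c + e) `^ p^-1)%R; have b0 : (0 < b)%R by rewrite powR_gt0.
have bp : (b `^ p = c + e)%R by rewrite -powRrM mulVf ?gt_eqF// powRr1// ltW.
rewrite /= lee_fin -bp ge0_ler_powR ?nnegrE ?(ltW b0) ?(ltW p0)//.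
  by rewrite mulr_ge0// ltW// invr_gt0.
rewrite ler_pdivrMl// mulrC -ler_pdivrMl//.
rewrite -[X in (X * _)%R]ger0_norm ?invr_ge0 ?(ltW b0)// -normrZ.
apply: KM; rewrite KZ ?invr_neq0 ?gt_eqF// Kf normfV (gtr0_norm b0) (powR_inv _ (ltW b0)) bp.
by rewrite -EFinM lee_fin ler_pdivrMl// mulr1 lerDl ltW.
Qed.

Lemma lsc_regularization_norm_bound K (p M : R) : (0 < p)%R -> (0 < M)%R ->
  (forall f, (M^-1 * `|f|)%:E `^ p <= K f) ->
  forall f, (M^-1 * `|f|)%:E `^ p <= lsc_regularization K f.
Proof.
move=> p0 M0 MK; apply: lsc_regularization_max => //.
apply: weak_star_lsc_poweR => //.
  by move=> f; rewrite lee_fin mulr_ge0// invr_ge0 ltW.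
under [X in weak_star_lsc X]eq_fun do rewrite EFinM.
by apply: weak_star_lscZ; rewrite ?invr_gt0//; exact: weak_star_lsc_norm.
Qed.

End Regularization.

(** * From a subadditive [p]-homogeneous gauge to a [p]-norm and a metric *)

Section Gauge.
Variables (R : realType) (V : lmodType R) (p : R) (s : V -> R).
Hypotheses (p_gt0 : 0 < p) (s_ge0 : forall f, 0 <= s f).
Hypothesis s_subadditive : forall f g, s (f + g) <= s f + s g.
Hypothesis s_homogeneous : forall a f, s (a *: f) = `|a| `^ p * s f.
Hypothesis s_eq0 : forall f, s f = 0 -> f = 0.

Lemma gauge0 : s 0 = 0.
Proof. by rewrite -(scale0r 0) s_homogeneous normr0 powR0 ?mul0r// gt_eqF. Qed.

Lemma gaugeN f : s (- f) = s f.
Proof. by rewrite -scaleN1r s_homogeneous normrN1 powR1 mul1r. Qed.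

(** The [p]-th power of the root is [s] again, so the [p]-triangle inequality is just subadditivity
    of [s]. *)
Lemma gauge_p_norm : p_norm p (fun f => s f `^ p^-1).
Proof.
have pN0 := lt0r_neq0 p_gt0.
have pV0 : 0 <= p^-1 by rewrite invr_ge0 ltW.
have sK f : (s f `^ p^-1) `^ p = s f by rewrite -powRrM mulVf// powRr1.
split; last by move=> f /powR_eq0_eq0; exact: s_eq0.
split; last by move=> f g; rewrite !sK.
split=> [f||]; first exact: powR_ge0.
  split=> [|a f _]; first by rewrite gauge0 powR0// invr_eq0.
  rewrite s_homogeneous powRM ?powR_ge0// -powRrM mulfV// EFinM.
(* The constant is the [p]-th root of the 2 in [sum_le]; the root of a maximum is then bounded by
   the sum of the roots. *)
exists (2 `^ p^-1) => f g.
have sum_le : s (f + g) <= 2 * Num.max (s f) (s g).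
  apply: le_trans (s_subadditive f g) _.
  by rewrite mulr_natl mulr2n lerD// le_max lexx ?orbT.
apply: le_trans (ge0_ler_powR pV0 _ _ sum_le) _; rewrite ?nnegrE//.
  by rewrite mulr_ge0// le_max s_ge0.
rewrite powRM ?le_max ?s_ge0// ler_wpM2l ?powR_ge0//.
by case: (leP (s f) (s g)) => _; rewrite ?lerDl ?lerDr powR_ge0.
Qed.

Lemma gauge_metric : is_metric (fun f g => s (f - g)).
Proof.
split=> //.
- move=> f g; split=> [/s_eq0/eqP|->]; first by rewrite subr_eq0 => /eqP.
  by rewrite subrr gauge0.
- by move=> f g; rewrite -gaugeN opprB.
- by move=> f g h; apply: le_trans (s_subadditive _ _); rewrite addrA subrK.
Qed.

End Gauge.

(** * Completeness under powers, and [p]-normability *)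

Section QuasiBanach.
Variable R : realType.

(** A positive power is strictly increasing, so smallness of [d] and of its power are
    interchangeable after adjusting the threshold. This carries completeness from the metric to the
    [p]-norm. *)
Lemma cauchy_complete_powR (T : Type) (d : T -> T -> R) (r : R) : 0 < r ->
  (forall x y, 0 <= d x y) -> cauchy_complete d ->
  cauchy_complete (fun x y => d x y `^ r).
Proof.
move=> r0 d0 dC u uC; have [e e0|l ul] := dC u.
  have [N uN] := uC (e `^ r) (powR_gt0 r e0).
  exists N => m n Nm Nn; have := uN m n Nm Nn; apply: contraTT.
  rewrite -!leNgt => e_le; by apply: ge0_ler_powR; rewrite ?nnegrE// ltW.
exists l; apply/cvgr0Pnorm_lt => e e0.
have er0 : 0 < e `^ r^-1 by rewrite powR_gt0.
near=> n; rewrite ger0_norm ?powR_ge0//.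
rewrite -[ltRHS](@powRr1 _ e) ?ltW// -(mulVf (lt0r_neq0 r0)) powRrM.
rewrite gt0_ltr_powR ?nnegrE ?powR_ge0//.
rewrite -[ltLHS]ger0_norm//; near: n.
by move/cvgr0Pnorm_lt : ul; exact.
Unshelve. all: by end_near. Qed.

Lemma p_norm_normable (V : lmodType R) (p : R) (N : V -> R) :
  p_norm p N -> p_normable p N.
Proof.
by move=> pN; exists N; split=> //; exists 1, 1; split=> // f; rewrite mul1r lexx.
Qed.

End QuasiBanach.

(** * The Banach space carried by a complete norm *)

Section NormedByGauge.
Variables (R : realType) (V : lmodType R) (N : V -> R).

Record complete_norm : Prop := CompleteNorm {
  complete_normD : forall f g, N (f + g) <= N f + N g;
  complete_normZ : forall a f, N (a *: f) = `|a| * N f;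
  complete_norm_eq0 : forall f, N f = 0 -> f = 0;
  complete_norm_cauchy : cauchy_complete (fun f g => N (f - g)) }.

(** An alias of [V] indexed by the proof [hN], to which the topology and norm given by [N] can be
    attached as canonical structures. *)
Definition normed_by (hN : complete_norm) : Type := V.

Variable hN : complete_norm.
Local Notation X := (normed_by hN).

HB.instance Definition _ := GRing.Lmodule.on X.
HB.instance Definition _ := @Lmodule_isNormed.Build R X N
  (complete_normD hN) (complete_normZ hN) (complete_norm_eq0 hN).

(** Filters reduce to sequences: choose balls of radius [n.+1%:R^-1] belonging to [F]. Any two of
    them meet, so their centres form a Cauchy sequence, whose limit is also the limit of [F]. *)
Lemma normed_by_cauchy_cvg (F : set_system X) :
  ProperFilter F -> cauchy F -> cvg F.
Proof.
move=> FF /cauchyP Fc.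
have inv_gt0 n : 0 < n.+1%:R^-1 :> R by rewrite invr_gt0.
have /choice[x xF] : forall n, exists x : X, F (ball x (n.+1%:R^-1 : R)).
  by move=> n; have [x Fx] := Fc _ (inv_gt0 n); exists x.
have dist m n : N (x m - x n) < m.+1%:R^-1 + n.+1%:R^-1.
  have [y []] := filter_ex (filterI (xF m) (xF n)).
  rewrite -!ball_normE /= => xmy xny.
  change (`|x m - x n| < m.+1%:R^-1 + n.+1%:R^-1).
  rewrite -(subrKA y); apply: le_lt_trans (ler_normD _ _) _.
  by rewrite ltrD// distrC.
have [e e0|l xl] := complete_norm_cauchy hN (u := x).
  have [k ke] : exists k, k.+1%:R^-1 < e / 2.
    have := near_infty_natSinv_lt (PosNum (divr_gt0 e0 (ltr0Sn R 1))).
    by case=> k _ /(_ k (leqnn k)) ke; exists k.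
  exists k => m n km kn; apply: lt_trans (dist m n) _.
  rewrite [ltRHS]splitr ltrD// (le_lt_trans _ ke)// lef_pV2 ?posrE ?ltr0n//.
    by rewrite ler_nat ltnS.
  by rewrite ler_nat ltnS.
apply/cvg_ex; exists (l : X); apply/cvgrPdist_lt => e e0.
(* At such an index the ball around [x n] lies inside the ball of radius [e] around [l]. *)
have [n [xnl ne]] : exists n, N (x n - l) < e / 2 /\ n.+1%:R^-1 < e / 2.
  have e20 : 0 < e / 2 by rewrite divr_gt0.
  have H1 := near_infty_natSinv_lt (PosNum e20).
  have /cvgr0Pnorm_lt/(_ _ e20) H2 := xl.
  have [n [/= n1 n2]] := filter_ex (filterI H1 H2).
  by exists n; split=> //; apply: le_lt_trans n2; exact: ler_norm.
apply: filterS (xF n) => y; rewrite -ball_normE /= => xny.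
rewrite -(subrKA (x n)); apply: le_lt_trans (ler_normD _ _) _.
rewrite [ltRHS]splitr ltrD//; last exact: lt_trans xny ne.
by rewrite distrC.
Qed.

HB.instance Definition _ := Uniform_isComplete.Build X normed_by_cauchy_cvg.

Lemma complete_norm_banach : banach N.
Proof.
pose phi : V -> X := idfun.
have phi_linear : linear phi by [].
pose lphi : {linear V -> X} := HB.pack phi (GRing.isLinear.Build _ _ _ _ _ phi_linear).
by exists X, lphi; split=> //; exists (idfun : X -> V).
Qed.

End NormedByGauge.

(** * Completeness through pointwise limits of functionals *)

Section DualCompleteness.
Variables (R : realType) (A : normedModType R).

Lemma dual_cauchy_limit (v : nat -> dual A) :
  (forall e : R, 0 < e -> exists N, forall m n, (N <= m)%N -> (N <= n)%N ->
    `|v m - v n| < e) ->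
  exists l : dual A, forall x, v n x @[n --> \oo] --> l x.
Proof.
move=> vC.
have vx x : cvg ((v n x : R) @[n --> \oo]).
  apply/cauchy_cvgP/cauchy_ballP => e e0.
  (* Adding 1 keeps the denominator positive at [x = 0]. *)
  have xe0 : 0 < e / (`|x| + 1) by rewrite divr_gt0// ltr_wpDl.
  have [N vN] := vC _ xe0.
  pose W := [set (v n x : R) | n in [set n | (N <= n)%N]].
  exists (W, W); first by split; exists N => // n Nn; exists n.
  move=> [_ _] /= [[m Nm <-] [n Nn <-]].
  change (`|dual_fun (v m - v n) x| < e).
  apply: le_lt_trans (dual_eval_le _ _) _.
  have := vN _ _ Nm Nn; rewrite ltr_pdivlMr ?ltr_wpDl//; apply: le_lt_trans.
  by rewrite ler_wpM2l// lerDl.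
pose l x : R^o := lim ((v n x : R) @[n --> \oo]).
have vl x : v n x @[n --> \oo] --> l x by exact: vx.
have l_linear : linear l.
  move=> a x y; apply: (cvg_lim (@Rhausdorff R)).
  rewrite (_ : (fun n => v n (a *: x + y) : R) = (fun n => a * v n x + v n y)).
    by apply: cvgD => //; apply: cvgM => //; exact: cvg_cst.
  by apply/funext => n; rewrite dual_linear.
have [N vN] := vC 1 ltr01.
(* Past index [N] the norms are at most that of [v N] plus 1. This bound survives the pointwise
   limit and makes [l] continuous. *)
have l_le x : `|l x| <= (`|v N| + 1) * `|x|.
  have lx : `|v n x| @[n --> \oo] --> `|l x| by apply: cvg_norm; exact: vl.
  apply: (cvgr_to_le lx); exists N => // n /= Nn.
  apply: le_trans (dual_eval_le _ _) _; apply: ler_wpM2r => //.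
  rewrite -(subrK (v N) (v n)) addrC; apply: le_trans (ler_normD _ _) _.
  by rewrite lerD2l ltW// vN.
pose ll : {linear A -> R^o} :=
  HB.pack l (GRing.isLinear.Build _ _ _ _ _ l_linear).
have l_continuous : continuous l.
  apply: (@bounded_linear_continuous _ _ _ ll).
  apply/bounded_funP => r; exists ((`|v N| + 1) * r) => x xr.
  apply: le_trans (l_le x) _; apply: ler_wpM2l => //.
by exists (exist _ (l : A -> R^o) (mem_set (conj l_linear l_continuous))).
Qed.

Variables (p M : R) (S : dual A -> \bar R).
Hypotheses (p_gt0 : 0 < p) (M_gt0 : 0 < M) (S_ge0 : forall f, (0 <= S f)%E).
Hypothesis S_lsc : weak_star_lsc S.
Hypothesis S_bound : forall f, ((M^-1 * `|f|)%:E `^ p <= S f)%E.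

(* A Cauchy sequence for [S] is Cauchy in norm, hence converges pointwise; its
   tail stays in a w*-closed sublevel set of [S] around each late term. *)
Lemma dual_gauge_complete
    (hF : linear_subspace [set f : dual A | (S f < +oo)%E]) :
  cauchy_complete (fun f g : subspace_type hF => fine (S (\val (f - g)))).
Proof.
move=> u uC; pose v n : dual A := \val (u n).
have vF (f : subspace_type hF) : (S (\val f) < +oo)%E.
  by have /set_mem := valP f.
have vC (e : R) : 0 < e -> exists N, forall m n, (N <= m)%N -> (N <= n)%N ->
    (S (v m - v n)%R <= e%:E)%E.
  move=> e0; have [N uN] := uC e e0; exists N => m n Nm Nn.
  rewrite -(@fineK _ (S (v m - v n))) ?lee_fin; first exact/ltW/uN.
  by rewrite ge0_fin_numE//; exact: (vF (u m - u n)).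
have [e e0|l vl] := @dual_cauchy_limit v.
  (* This threshold is what [S_bound] turns into a norm bound by [e / 2]; halving absorbs the
     passage from [<=] to [<]. *)
  have Me0 : 0 < M^-1 * (e / 2) by rewrite mulr_gt0 ?invr_gt0 ?divr_gt0.
  have [N vN] := vC ((M^-1 * (e / 2)) `^ p) (powR_gt0 p Me0).
  exists N => m n Nm Nn; apply: (@le_lt_trans _ _ (e / 2)); last first.
    by rewrite ltr_pdivrMr// ltr_pMr// ltr1n.
  have := le_trans (S_bound _) (vN m n Nm Nn); rewrite /= lee_fin.
  apply: contraTT; rewrite -!ltNge => elt.
  have ge0 : 0 <= M^-1 * (e / 2) by exact: ltW.
  rewrite gt0_ltr_powR ?nnegrE ?mulr_ge0 ?invr_ge0 ?(ltW M_gt0)//.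
    exact: ltW.
  by rewrite ltr_pM2l ?invr_gt0.
have lC (e : R) : 0 < e -> exists N, forall n, (N <= n)%N ->
    (S (v n - l)%R <= e%:E)%E.
  move=> e0; have [N vN] := vC e e0; exists N => n Nn.
  have vnl : (fun m => v n - v m) @ \oo --> (v n - l : weak_star A).
    apply: weak_star_cvg => x.
    have : (v n x - v m x : R^o) @[m --> \oo] --> (v n x - l x : R^o).
      exact: (cvgB (cvg_cst _) (vl x)).
    exact.
  have vne : \forall m \near \oo, [set f | (S f <= e%:E)%E] (v n - v m).
    by exists N => // m /= Nm; exact: vN.
  exact: (closed_cvg _ (@S_lsc e) vne _ vnl).
have Fl : l \in [set f : dual A | (S f < +oo)%E].
  have [N /(_ N (leqnn N)) lN] := lC 1 ltr01.
  (* Finiteness at [l] follows from finiteness at [v N - l] and [v N], because the domain is a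
     subspace. *)
  apply/mem_set; rewrite (_ : l = (-1) *: (v N - l) + v N).
    apply: (proj2 hF); [exact: le_lt_trans lN (ltry _)|exact: vF].
  by rewrite scaleN1r opprB subrK.
exists (exist _ l Fl); apply/cvgr0Pnorm_le => e e0.
have [N lN] := lC e e0; exists N => // n /= Nn.
rewrite ger0_norm ?fine_ge0//.
rewrite -lee_fin fineK; first exact: lN.
by rewrite ge0_fin_numE//; exact: le_lt_trans (lN n Nn) (ltry _).
Qed.

End DualCompleteness.

Theorem theorem3p7 (R : realType) (A : completeNormedModType R)
    (A_separable : separable_space A)
    (Theta : Type) (model : Theta -> dual A) (C : Theta -> R)
    (C_ge0 : forall t, 0 <= C t)
    (q p : R) (q_gt0 : 0 < q) (p_gt0 : 0 < p) (p_le1 : p <= 1)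
    (Q : dual A -> \bar R) (Q_ge0 : forall f, (0 <= Q f)%E)
    (Q_subadditive : ereal_subadditive Q) (Q_homogeneous : abs_homogeneous p Q)
    (R_Theta_eq : forall f, representation_cost model C f = (Q f `^ q)%E)
    (R_Theta_coercive : coercive (representation_cost model C)) :
  let Rreg := lsc_regularization (representation_cost model C) in
  exists hF : linear_subspace [set f : dual A | (Rreg f < +oo)%E],
    let F := subspace_type hF in
    let N (f : F) : R := fine (Rreg (\val f) `^ (p * q)^-1%R)%E in
    let d (f g : F) : R := fine (Rreg (\val (f - g)%R) `^ q^-1%R)%E in
    [/\ p_norm p N,
        is_metric d /\ cauchy_complete d,
        p_normable p N /\ quasi_banach N
      & p = 1 -> banach N].
Proof.
move=> Rreg.
have qN0 := lt0r_neq0 q_gt0.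
have cost_eq : representation_cost model C = (fun f => Q f `^ q)%E.
  exact/funext.
pose S := lsc_regularization Q.
have RregE : Rreg = (fun f => S f `^ q)%E.
  apply/funext => f; rewrite /Rreg cost_eq.
  exact: lsc_regularization_poweR.
have S_ge0 f : (0 <= S f)%E by exact: lsc_regularization_ge0.
have S_sub : ereal_subadditive S by exact: lsc_regularization_subadditive.
have [S0 SZ] : abs_homogeneous p S by exact: lsc_regularization_homogeneous.
have [M M_gt0 S_bound] : exists2 M : R, 0 < M &
    forall f, ((M^-1 * `|f|)%:E `^ p <= S f)%E.
  have [M M_gt0 Q_bound] : exists2 M : R, 0 < M &
      forall f, ((M^-1 * `|f|)%:E `^ p <= Q f)%E.
    apply: (homogeneous_coercive_bound p_gt0 q_gt0) => //.
    by rewrite -cost_eq.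
  by exists M => //; exact: lsc_regularization_norm_bound.
(* As [q] is positive, the two functions are finite at the same points, so the subspace can be built
   from [S]. *)
have finE : [set f : dual A | (Rreg f < +oo)%E] = [set f | (S f < +oo)%E].
  apply/seteqP; split=> f /=; rewrite RregE; first exact: lty_poweRy.
  exact: poweR_lty.
rewrite finE.
have hF : linear_subspace [set f : dual A | (S f < +oo)%E].
  split=> [|a f g /= Sf Sg]; first by rewrite /= S0.
  apply: le_lt_trans (S_sub _ _) _; apply: lte_add_pinfty => //.
  have [->|a0] := eqVneq a 0; first by rewrite scale0r S0.
  by rewrite SZ// lte_mul_pinfty// lee_fin powR_ge0.
exists hF => F N d.
(* All claims reduce to this real gauge: [d] is [s] of a difference and [N] is the [p]-th root of
   [s]. *)
pose s (f : F) := fine (S (\val f)).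
have sE (f : F) : ((s f)%:E = S (\val f))%E.
  by rewrite fineK// ge0_fin_numE//; have /set_mem := valP f.
have s_ge0 f : 0 <= s f by rewrite fine_ge0.
have s_sub f g : s (f + g) <= s f + s g.
  by rewrite -lee_fin EFinD !sE; exact: S_sub.
have sZ a f : s (a *: f) = `|a| `^ p * s f.
  apply/EFin_inj; rewrite EFinM !sE.
  have [->|a0] := eqVneq a 0; last exact: SZ.
  by rewrite scale0r S0 normr0 powR0 ?mul0e// lt0r_neq0.
(* Definiteness comes from the lower bound of [S] by a power of the norm, hence ultimately from
   coercivity. *)
have s_eq0 f : s f = 0 -> f = 0.
  move=> sf0; apply/val_inj; apply/eqP; rewrite -normr_le0.
  have := S_bound (\val f); rewrite -sE sf0 /= lee_fin => h.
  have /powR_eq0_eq0/eqP : (M^-1 * `|\val f : dual A|) `^ p = 0.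
    by apply/eqP; rewrite eq_le h powR_ge0.
  by rewrite mulf_eq0 invr_eq0 (negbTE (lt0r_neq0 M_gt0)) /= => /eqP ->.
have NE : N = (fun f => s f `^ p^-1).
  apply/funext => f; rewrite /N RregE invfM [(_^-1 * _)%R]mulrC poweRrM poweRK//.
  by rewrite -sE.
have dE : d = (fun f g => s (f - g)).
  by apply/funext => f; apply/funext => g; rewrite /d RregE poweRK.
have N_norm : p_norm p N by rewrite NE; exact: gauge_p_norm.
have d_complete : cauchy_complete d.
  rewrite dE; apply: (dual_gauge_complete p_gt0 M_gt0) => //.
  exact: lsc_regularization_lsc.
have N_complete : cauchy_complete (fun f g : F => N (f - g)).
  rewrite NE; rewrite dE in d_complete.
  by apply: cauchy_complete_powR; rewrite ?invr_gt0.
split=> //.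
- by split=> //; rewrite dE; exact: (gauge_metric p_gt0).
- split; first exact: p_norm_normable.
  split; last exact: N_complete.
  by case: N_norm => -[].
(* For [p = 1] the root disappears, and [s] itself is a complete norm. *)
- move=> p1; rewrite p1 in sZ NE.
  have {}NE : N = s by rewrite NE; apply/funext => f; rewrite invr1 powRr1.
  apply: complete_norm_banach; split=> //; rewrite ?NE//.
  by move=> a f; rewrite sZ powRr1.
Qed.
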